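(* Let $(X,d)$ be a forwards continuous asymmetric metric space satisfying the following property: ( * ) if $\{x_m\}_{m\ge 1}\subset X$ is a forwards admissible sequence that has a closest forward limit $x\in X$, then $\{x_m\}$ is also backwards admissible and $x$ is its closest backward limit. Then there is a forwards complete asymmetric metric space $(\hat X,\hat d)$ and an isometric embedding $\iota\colon X\to\hat X$ such that $\hat X$ is semi forwards continuous with respect to $\mathrm{Im}(\iota)$ and $\iota(X)$ is forwards dense in $\hat X$; moreover, such a space $(\hat X,\hat d)$ is unique up to isometry.
   Context: An asymmetric metric on a set $X$ is a function $d\colon X\times X\to[0,\infty]$ such that $d(x,x)=0$; $d(x,y)=d(y,x)=0$ implies $x=y$; and $d(x,z)\le d(x,y)+d(y,z)$ for all $x,y,z$. An isometric embedding is a map preserving $d$ (as an ordered-pair function); an isometry is a bijective isometric embedding. A point $x$ is a forward limit of $\{x_m\}$ if $\lim_m d(x_m,x)=0$; it is the closest forward limit (CFL) if moreover $d(x,y)=0$ for every $y\in X$ with $\lim_m d(x_m,y)=0$ (a CFL is unique if it exists). The closest backward limit (CBL) is defined by switching the order of the arguments of $d$: $\lim_m d(x,x_m)=0$, and $d(y,x)=0$ whenever $\lim_m d(y,x_m)=0$. A sequence $\{x_m\}$ is forwards admissible if for every $\varepsilon>0$ there is $N(\varepsilon)$ such that for every $m>N(\varepsilon)$ there is $K(m,\varepsilon)>m$ with $d(x_m,x_k)<\varepsilon$ for all $k>K(m,\varepsilon)$. It is backwards admissible if the same holds with $d(x_k,x_m)<\varepsilon$ in place of $d(x_m,x_k)<\varepsilon$.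 $(X,d)$ is forwards continuous if for every forwards admissible sequence $\{x_m\}$ with CFL $x$ and every $y\in X$, $d(x,y)=\lim_m d(x_m,y)$ and $d(y,x)=\lim_m d(y,x_m)$. An asymmetric metric space is forwards complete if every forwards admissible sequence in it has a CFL. For $A\subset Y$: $A$ is forwards dense in $Y$ if every $y\in Y$ is the CFL (in $Y$) of some forwards admissible sequence contained in $A$. $Y$ is semi forwards continuous with respect to $A$ if for all $a,b\in Y$ and all forwards admissible sequences $\{a_m\},\{b_m\}\subset A$ with CFLs $a$ and $b$ respectively, $d(a,b)=\lim_{m\to\infty}\lim_{k\to\infty}d(a_m,b_k)$. (For forwards admissible sequences this iterated limit always exists in $[0,\infty]$.) *)

(* Defs.v *)
(* The value set [0, +oo] of an asymmetric metric is rendered by the extended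
   reals with a nonnegativity axiom; limits are taken in the topology of
   \bar R, so convergence to +oo is allowed.  Sequences are indexed from 0. *)
From mathcomp Require Import all_boot all_order all_algebra.
From mathcomp Require Import all_classical all_reals all_analysis.

Set Implicit Arguments.
Unset Strict Implicit.
Unset Printing Implicit Defensive.

Import Order.TTheory GRing.Theory Num.Theory.
Import numFieldNormedType.Exports.

Local Open Scope classical_set_scope.
Local Open Scope ring_scope.
Local Open Scope ereal_scope.

Record asymmetric_metric (R : realType) (X : Type) (d : X -> X -> \bar R) :
    Prop := AsymmetricMetric {
  asym_ge0 : forall x y, 0 <= d x y ;
  asym_refl : forall x, d x x = 0 ;
  asym_sep : forall x y, d x y = 0 -> d y x = 0 -> x = y ;
  asym_triangle : forall x y z, d x z <= d x y + d y z }.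

Definition isometric_embedding (R : realType) (X Y : Type)
    (dX : X -> X -> \bar R) (dY : Y -> Y -> \bar R) (f : X -> Y) : Prop :=
  forall x x', dY (f x) (f x') = dX x x'.

Definition asym_isometry (R : realType) (X Y : Type)
    (dX : X -> X -> \bar R) (dY : Y -> Y -> \bar R) (f : X -> Y) : Prop :=
  isometric_embedding dX dY f /\ bijective f.

Section AsymmetricSpace.
Variables (R : realType) (X : Type) (d : X -> X -> \bar R).

Definition forward_limit (u : nat -> X) (x : X) : Prop :=
  d (u m) x @[m --> \oo] --> 0.

Definition backward_limit (u : nat -> X) (x : X) : Prop :=
  d x (u m) @[m --> \oo] --> 0.

Definition is_CFL (u : nat -> X) (x : X) : Prop :=
  forward_limit u x /\ forall y, forward_limit u y -> d x y = 0.

Definition is_CBL (u : nat -> X) (x : X) : Prop :=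
  backward_limit u x /\ forall y, backward_limit u y -> d y x = 0.

Definition forwards_admissible (u : nat -> X) : Prop :=
  forall e : R, (0 < e)%R -> exists N : nat, forall m : nat, (N < m)%N ->
    exists2 K : nat, (m < K)%N & forall k : nat, (K < k)%N ->
      d (u m) (u k) < e%:E.

Definition backwards_admissible (u : nat -> X) : Prop :=
  forall e : R, (0 < e)%R -> exists N : nat, forall m : nat, (N < m)%N ->
    exists2 K : nat, (m < K)%N & forall k : nat, (K < k)%N ->
      d (u k) (u m) < e%:E.

Definition forwards_continuous : Prop :=
  forall (u : nat -> X) (x : X), forwards_admissible u -> is_CFL u x ->
    forall y : X, (d (u m) y @[m --> \oo] --> d x y) /\
                  (d y (u m) @[m --> \oo] --> d y x).

Definition forwards_complete : Prop :=
  forall u : nat -> X, forwards_admissible u -> exists x : X, is_CFL u x.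

Definition CFL_are_CBL : Prop :=
  forall (u : nat -> X) (x : X), forwards_admissible u -> is_CFL u x ->
    backwards_admissible u /\ is_CBL u x.

Definition forwards_dense (A : set X) : Prop :=
  forall y : X, exists u : nat -> X,
    [/\ forall m, A (u m), forwards_admissible u & is_CFL u y].

(* l m is the inner limit lim_k d(a_m, b_k): the existence of both limits is
   asserted rather than left to a default value of [lim].  For an asymmetric
   metric and forwards admissible a_ and b_ both limits always exist. *)
Definition semi_forwards_continuous (A : set X) : Prop :=
  forall (a b : X) (a_ b_ : nat -> X),
    (forall m, A (a_ m)) -> (forall m, A (b_ m)) ->
    forwards_admissible a_ -> forwards_admissible b_ ->
    is_CFL a_ a -> is_CFL b_ b ->
    exists2 l : nat -> \bar R,
      (forall m, d (a_ m) (b_ k) @[k --> \oo] --> l m) &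
      l m @[m --> \oo] --> d a b.

End AsymmetricSpace.

Record forwards_completion (R : realType) (X : Type) (d : X -> X -> \bar R)
    (Y : Type) (dY : Y -> Y -> \bar R) (iota : X -> Y) : Prop :=
    ForwardsCompletion {
  completion_metric : asymmetric_metric dY ;
  completion_complete : forwards_complete dY ;
  completion_embedding : isometric_embedding d dY iota ;
  completion_semi_continuous : semi_forwards_continuous dY (range iota) ;
  completion_dense : forwards_dense dY (range iota) }.

(* Main.v *)
(* A forwards admissible sequence u of X is recorded by the function
   g = lim_k d(-, u_k) on X, and the completion consists of all such functions
   with dhat(g, h) = inf {e >= 0 | h <= g + e}.  This equals the iterated limit
   lim_m lim_k d(u_m, v_k) = lim_m h(u_m), whereas the metric axioms are
   immediate from the infimum and no quotient is needed; X embeds by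
   x |-> d(-, x), for which dhat(iota x, h) = h(x).  An admissible sequence
   (g_n) of the completion, with g_n recording u^n, converges to the function
   recording a diagonal sequence x_m = u^m_(c_m): dhat(g_m, iota x) need not be
   small for x in u^m, so c_m is chosen large enough that d(y, x_m) is almost
   g_m(y) for all the finitely many y = u^n_j with n, j <= m.
   Semi forwards continuity forces the distances in any completion to be the
   iterated limits of d, hence the uniqueness. *)
Require Import Defs.
From mathcomp Require Import all_boot all_order all_algebra lra.
From mathcomp Require Import all_classical all_reals all_analysis.

Set Implicit Arguments.
Unset Strict Implicit.
Unset Printing Implicit Defensive.

Import Order.TTheory GRing.Theory Num.Theory.
Import numFieldNormedType.Exports.

Local Open Scope classical_set_scope.
Local Open Scope ring_scope.
Local Open Scope ereal_scope.

(** * Limits of almost monotone sequences of extended reals *)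

Lemma almost_nonincreasing_cvg (R : realType) (u : nat -> \bar R) :
  (forall e : R, (0 < e)%R ->
    \forall m \near \oo, \forall k \near \oo, u k <= u m + e%:E) ->
  cvgn u.
Proof.
move=> u_noninc.
(* For each large [m] the limsup is at most [u m + e]; letting [m] grow, it is at most the liminf
   plus [e]. The two envelopes then squeeze [u], possibly towards an infinite limit. *)
have supE : limn (esups u) = limn (einfs u).
  apply/eqP; rewrite eq_le -limn_esup_lim -limn_einf_lim limn_einf_sup andbT.
  apply/lee_addgt0Pr => e e0.
  have [N _ uN] := u_noninc e e0.
  rewrite -leeBlDr// limn_einf_lim; apply: lime_ge; first exact: is_cvg_einfs.
  exists N => // n /= Nn; apply: le_ereal_inf_tmp => _ [m /= nm <-].
  have [K _ uK] := uN m (leq_trans Nn nm).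
  suff : limn_esup u <= u m + e%:E by rewrite -leeBlDr.
  rewrite limn_esup_lim; apply: lime_le; first exact: is_cvg_esups.
  exists K => // k /= Kk; apply: ge_ereal_sup => _ [j /= kj <-].
  exact: uK (leq_trans Kk kj).
apply/cvg_ex; exists (limn (einfs u)).
apply: (@squeeze_cvge _ _ _ _ (einfs u) u (esups u)).
- apply: nearW => n; apply/andP; split.
    by apply: ereal_inf_lbound; exists n => /=.
  by apply: ereal_sup_ubound; exists n => /=.
- exact: is_cvg_einfs.
- by rewrite -supE; exact: is_cvg_esups.
Qed.

Lemma almost_nondecreasing_cvg (R : realType) (u : nat -> \bar R) :
  (forall e : R, (0 < e)%R ->
    \forall m \near \oo, \forall k \near \oo, u m <= u k + e%:E) ->
  cvgn u.
Proof.
move=> u_nondec; rewrite -(is_cvgeNE u).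
apply: almost_nonincreasing_cvg => e e0.
apply: filterS (u_nondec e e0) => m; apply: filterS => k.
by rewrite -leeBlDr// leeNl oppeD ?fin_num_adde_defl// oppeK.
Qed.

Lemma cvg0_leP (R : realType) (u : nat -> \bar R) :
  (forall m, 0 <= u m) ->
  u m @[m --> \oo] --> 0 <->
  forall e : R, (0 < e)%R -> \forall m \near \oo, u m <= e%:E.
Proof.
move=> u0; split=> [/fine_cvgP[ufin /cvgr0Pnorm_le u_lim] e e0|u_le].
  near=> m.
  have /fineK <- : u m \is a fin_num by near: m.
  rewrite lee_fin (le_trans (ler_norm _))//; near: m; exact: u_lim.
apply/fine_cvgP; split.
  apply: filterS (u_le 1%R ltr01) => m um.
  by rewrite ge0_fin_numE// (le_lt_trans um)// ltry.
apply/cvgr0Pnorm_le => e e0.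
apply: filterS (u_le e e0) => m um.
rewrite /= ger0_norm ?fine_ge0// -lee_fin fineK//.
by rewrite ge0_fin_numE// (le_lt_trans um)// ltry.
Unshelve. all: by end_near. Qed.

Lemma ge0_cvgeD (R : realType) (u v : nat -> \bar R) (a b : \bar R) :
  0 <= a -> 0 <= b -> u m @[m --> \oo] --> a -> v m @[m --> \oo] --> b ->
  u m + v m @[m --> \oo] --> a + b.
Proof. by move=> a0 b0; apply: cvgeD; apply: ge0_adde_def; rewrite inE. Qed.

(** * Admissible sequences and closest forward limits *)

Section AdmissibleSequences.
Variables (R : realType) (X : Type) (d : X -> X -> \bar R).
Hypothesis d_metric : asymmetric_metric d.

Lemma forwards_admissibleP (u : nat -> X) :
  forwards_admissible d u <->
  forall e : R, (0 < e)%R ->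
    \forall m \near \oo, \forall k \near \oo, d (u m) (u k) < e%:E.
Proof.
split=> u_adm e e0.
  have [N uN] := u_adm e e0.
  exists N.+1 => // m /= Nm; have [K _ uK] := uN m Nm.
  by exists K.+1 => // k /= Kk; exact: uK.
have [N _ uN] := u_adm e e0; exists N => m Nm.
have [K _ uK] := uN m (ltnW Nm).
exists (maxn K m.+1); first by rewrite leq_max leqnn orbT.
by move=> k; rewrite gtn_max => /andP[Kk _]; exact/uK/ltnW.
Qed.

Lemma admissible_cst (x : X) : forwards_admissible d (fun=> x).
Proof.
apply/forwards_admissibleP => e e0; apply: nearW => m; apply: nearW => k.
by rewrite (asym_refl d_metric) lte_fin.
Qed.

Lemma is_CFL_cst (x : X) : is_CFL d (fun=> x) x.
Proof.
split; first by rewrite /forward_limit (asym_refl d_metric); exact: cvg_cst.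
by move=> y xy; apply: (cvg_unique _ _ xy) => //; exact: cvg_cst.
Qed.

Lemma is_CFL_unique (u : nat -> X) (x y : X) :
  is_CFL d u x -> is_CFL d u y -> x = y.
Proof.
by move=> [ux xP] [uy yP]; apply: (asym_sep d_metric); [exact: xP|exact: yP].
Qed.

(** Since [d y (u k) <= d y (u m) + d (u m) (u k)], the distances from [y] are almost
    nonincreasing. *)
Lemma admissible_dist_cvg (u : nat -> X) (y : X) :
  forwards_admissible d u -> cvgn (fun k => d y (u k)).
Proof.
move=> /forwards_admissibleP u_adm; apply: almost_nonincreasing_cvg => e e0.
apply: filterS (u_adm e e0) => m; apply: filterS => k /ltW umk.
exact: le_trans (asym_triangle d_metric y (u m) (u k)) (leeD2l _ umk).
Qed.

End AdmissibleSequences.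

(** * Profiles of admissible sequences and the distance between them *)

Section Profiles.
Variables (R : realType) (X : Type) (d : X -> X -> \bar R).
Hypothesis d_metric : asymmetric_metric d.

Definition represents (u : nat -> X) (g : X -> \bar R) : Prop :=
  forwards_admissible d u /\ forall y, d y (u k) @[k --> \oo] --> g y.

(** For profiles, this is the supremum of the positive part of [h - g], written without subtraction
    because both values can be [+oo]. *)
Definition profile_dist (g h : X -> \bar R) : \bar R :=
  ereal_inf [set e | 0 <= e /\ forall y, h y <= g y + e].

Lemma profile_dist_ge0 (g h : X -> \bar R) : 0 <= profile_dist g h.
Proof. by apply: le_ereal_inf_tmp => e []. Qed.

Lemma profile_dist_le (g h : X -> \bar R) (e : \bar R) :
  0 <= e -> (forall y, h y <= g y + e) -> profile_dist g h <= e.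
Proof. by move=> e0 gh; exact: ereal_inf_lbound. Qed.

(** The infimum is attained: some admissible bound lies within any [e > 0] of it, and [e] tends to
    0. *)
Lemma le_add_profile_dist (g h : X -> \bar R) (y : X) :
  0 <= g y -> h y <= g y + profile_dist g h.
Proof.
move=> gy0; have := profile_dist_ge0 g h.
case D : (profile_dist g h) => [r| |] // _; last first.
  by rewrite addey ?leey// gt_eqF// (lt_le_trans ltNy0).
apply/lee_addgt0Pr => e e0.
have Dfin : profile_dist g h \is a fin_num by rewrite D.
have [x [x0 ghx]] := lb_ereal_inf_adherent e0 Dfin.
rewrite -/(profile_dist g h) D => /ltW xD.
by rewrite -addeA; exact: le_trans (ghx y) (leeD2l _ xD).
Qed.

Lemma exists_represents (u : nat -> X) :
  forwards_admissible d u -> exists g, represents u g.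
Proof.
move=> u_adm; exists (fun y => limn (fun k => d y (u k))); split=> // y.
exact: admissible_dist_cvg.
Qed.

Lemma represents_cst (x : X) : represents (fun=> x) (d^~ x).
Proof. by split=> [|y]; [exact: admissible_cst|exact: cvg_cst]. Qed.

Section OneProfile.
Variables (u : nat -> X) (g : X -> \bar R).
Hypothesis ug : represents u g.

Lemma profile_ge0 (y : X) : 0 <= g y.
Proof.
apply: (cvge_to_ge (ug.2 y)); apply: nearW => k; exact: asym_ge0 d_metric _ _.
Qed.

Lemma profile_triangle (x y : X) : g y <= d y x + g x.
Proof.
apply: (@lee_cvg_to _ \oo _ _
  (fun k => d y (u k)) (fun k => d y x + d x (u k))).
- exact: ug.2.
- apply: ge0_cvgeD; [|exact: profile_ge0|exact: cvg_cst|exact: ug.2].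
  exact: asym_ge0 d_metric _ _.
- by apply: nearW => k; exact: asym_triangle d_metric _ _ _.
Qed.

(** Admissibility makes [lim_k d (u m) (u k)] small for large [m]. As [g (u m)] will be the distance
    from the image of [u m] to [g], this is forward convergence of [u] to [g]. *)
Lemma profile_cvg0 : g (u m) @[m --> \oo] --> 0.
Proof.
apply/cvg0_leP => [m|e e0]; first exact: profile_ge0.
move: ug => [/forwards_admissibleP/(_ e e0) + gE].
apply: filterS => m umk; apply: (cvge_to_le (gE _)).
by apply: filterS umk => k /ltW.
Qed.

(** A function that is 1-Lipschitz in this one-sided sense is controlled everywhere by its values
    along [u]: let [m] grow in [h y <= d y (u m) + h (u m)]. *)
Lemma profile_le_add (h : X -> \bar R) (b : nat -> \bar R) (e : \bar R) :
  0 <= e -> (forall x y, h y <= d y x + h x) ->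
  (\forall m \near \oo, h (u m) <= b m) -> b m @[m --> \oo] --> e ->
  forall y, h y <= g y + e.
Proof.
move=> e0 h_lip hu be y.
apply: (cvge_to_ge (ge0_cvgeD (profile_ge0 y) e0 (ug.2 y) be)).
by apply: filterS hu => m hm; exact: le_trans (h_lip _ _) (leeD2l _ hm).
Qed.

End OneProfile.

(** The values [h (u m)] are almost nondecreasing, so a limit [l] exists. It is at most the distance
    because [g (u m)] tends to 0, and at least the distance because [l] is an admissible bound in
    the infimum. *)
Lemma cvg_profile_dist (u v : nat -> X) (g h : X -> \bar R) :
  represents u g -> represents v h ->
  h (u m) @[m --> \oo] --> profile_dist g h.
Proof.
move=> ug vh.
have h_lip := profile_triangle vh.
have h_ge0 := profile_ge0 vh.
have /cvg_ex[l ul] : cvgn (h \o u).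
  apply: almost_nondecreasing_cvg => e e0.
  have /forwards_admissibleP/(_ e e0) := ug.1.
  apply: filterS => m; apply: filterS => k /ltW umk /=.
  by apply: le_trans (h_lip (u k) (u m)) _; rewrite addeC leeD2l.
suff <- : l = profile_dist g h by [].
have l0 : 0 <= l by apply: (cvge_to_ge ul); apply: nearW => m; exact: h_ge0.
apply/eqP; rewrite eq_le; apply/andP; split.
  have D_lim : g (u m) + profile_dist g h @[m --> \oo] --> 0 + profile_dist g h.
    apply: ge0_cvgeD => //; first exact: profile_dist_ge0.
      exact: profile_cvg0.
    exact: cvg_cst.
  rewrite add0e in D_lim; apply: (lee_cvg_to ul D_lim); apply: nearW => m /=.
  exact/le_add_profile_dist/(profile_ge0 ug).
apply: profile_dist_le => //; apply: (profile_le_add ug l0 h_lip _ ul).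
exact: nearW.
Qed.

Lemma represents_near_le (u : nat -> X) (g : X -> \bar R) (y : X) (e : R) :
  represents u g -> (0 < e)%R ->
  \forall k \near \oo, d y (u k) <= g y + e%:E.
Proof.
move=> ug e0.
(* Where [g y = +oo] the strict inequality [g y < g y + e] fails, but the claim is trivial. *)
have [gy|] := eqVneq (g y) +oo.
  by apply: nearW => k; rewrite gy addye ?leey.
move=> gy; have gyfin : g y \is a fin_num.
  by rewrite ge0_fin_numE ?(profile_ge0 ug)// lt_neqAle gy leey.
have gy_lt : g y < g y + e%:E by rewrite lteDl.
have : \forall k \near \oo, d y (u k) < g y + e%:E.
  exact: (ug.2 y _ (open_ereal_lt' gy_lt)).
by apply: filterS => k /ltW.
Qed.

Lemma profile_dist_cst (v : nat -> X) (x : X) (h : X -> \bar R) :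
  represents v h -> profile_dist (d^~ x) h = h x.
Proof.
move=> vh; have := cvg_profile_dist (represents_cst x) vh.
by move=> hx; apply: (cvg_unique _ hx); [|exact: cvg_cst].
Qed.

Lemma profile_dist_refl (u : nat -> X) (g : X -> \bar R) :
  represents u g -> profile_dist g g = 0.
Proof.
move=> ug; have gu := cvg_profile_dist ug ug.
by apply: (cvg_unique _ gu); [|exact: profile_cvg0].
Qed.

(** The last clause puts each [x n] among the points tested in the second one, so that later terms
    are controlled at [x n]. *)
Lemma diagonal_sequence (u : nat -> nat -> X) (g : nat -> X -> \bar R) :
  (forall n, represents (u n) (g n)) ->
  exists x : nat -> X, [/\
    forall m, g m (x m) <= (m.+1%:R^-1)%:E,
    forall n j m, (n <= m)%N -> (j <= m)%N ->
      d (u n j) (x m) <= g m (u n j) + (m.+1%:R^-1)%:E &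
    forall n, exists j, x n = u n j].
Proof.
move=> ug.
suff /choice[c cP] : forall m, exists c, g m (u m c) <= (m.+1%:R^-1)%:E /\
    forall n j, (n <= m)%N -> (j <= m)%N ->
      d (u n j) (u m c) <= g m (u n j) + (m.+1%:R^-1)%:E.
  exists (fun m => u m (c m)); split=> [m|n j m nm jm|n].
  - exact: (cP m).1.
  - exact: (cP m).2.
  - by exists (c n).
move=> m; have m0 : (0 < m.+1%:R^-1 :> R)%R by [].
have gm : \forall k \near \oo, g m (u m k) <= (m.+1%:R^-1)%:E.
  apply: (cvg0_leP (fun k => profile_ge0 (ug m) (u m k))).1 => //.
  exact: profile_cvg0.
(* Only finitely many pairs are involved, so their eventual bounds hold simultaneously. *)
have dm : \forall k \near \oo, forall p : 'I_m.+1 * 'I_m.+1,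
    d (u p.1 p.2) (u m k) <= g m (u p.1 p.2) + (m.+1%:R^-1)%:E.
  by apply: filter_forall => p; exact: represents_near_le.
have [c _ /(_ c (leqnn c))[gc dc]] := filterI gm dm.
exists c; split=> // n j nm jm.
exact: (dc (Ordinal (nm : n < m.+1)%N, Ordinal (jm : j < m.+1)%N)).
Qed.

(** * The space of profiles and its forward completeness *)

Definition completion := {g : X -> \bar R | exists u, represents u g}.

Definition completion_dist (g h : completion) : \bar R :=
  profile_dist (sval g) (sval h).

Definition completion_embed (x : X) : completion :=
  exist _ (d^~ x) (ex_intro _ (fun=> x) (represents_cst x)).

Lemma completion_dist_embed (x : X) (h : completion) :
  completion_dist (completion_embed x) h = sval h x.
Proof. by case: h => h [v vh]; exact: profile_dist_cst vh. Qed.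

Lemma completion_dist_metric : asymmetric_metric completion_dist.
Proof.
split.
- by move=> g h; exact: profile_dist_ge0.
- by case=> g [u ug]; exact: profile_dist_refl ug.
- move=> [g [u ug]] [h [v vh]]; rewrite /completion_dist /= => gh hg.
  apply: eq_exist; apply/funext => y; apply/eqP; rewrite eq_le; apply/andP; split.
    by have := le_add_profile_dist g (profile_ge0 vh y); rewrite hg adde0.
  by have := le_add_profile_dist h (profile_ge0 ug y); rewrite gh adde0.
- move=> [g [u ug]] [h [v vh]] [f ?]; rewrite /completion_dist /=.
  apply: profile_dist_le => [|y]; first by rewrite adde_ge0 ?profile_dist_ge0.
  apply: le_trans (le_add_profile_dist f (profile_ge0 vh y)) _.
  by rewrite addeA leeD2r//; exact: le_add_profile_dist (profile_ge0 ug y).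
Qed.

Lemma completion_embed_isometric :
  isometric_embedding d completion_dist completion_embed.
Proof. by move=> x y; rewrite completion_dist_embed. Qed.

(** Being a forward limit [h] means that [h (u m)] tends to 0; it also tends to the distance from
    [g] to [h], which therefore vanishes. *)
Lemma represents_is_CFL (u : nat -> X) (g : completion) :
  represents u (sval g) ->
  is_CFL completion_dist (completion_embed \o u) g.
Proof.
move=> ug.
have flE h : forward_limit completion_dist (completion_embed \o u) h =
    (sval h (u m) @[m --> \oo] --> 0).
  by rewrite /forward_limit; under eq_fun do rewrite /= completion_dist_embed.
split=> [|h]; rewrite flE; first exact: profile_cvg0.
case: h => h [v vh] /= hu0.
have hu := cvg_profile_dist ug vh.
by apply: (cvg_unique _ hu hu0).
Qed.

Lemma completion_forwards_complete : forwards_complete completion_dist.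
Proof.
move=> U /forwards_admissibleP U_adm.
have /choice[u uU] : forall n, exists u, represents u (sval (U n)).
  by move=> n; exact: svalP (U n).
pose g n := sval (U n).
have g_adm (e : R) : (0 < e)%R ->
    \forall n \near \oo, \forall m \near \oo, forall y, g m y <= g n y + e%:E.
  move=> e0; apply: filterS (U_adm e e0) => n; apply: filterS => m /ltW Unm y.
  apply: le_trans (le_add_profile_dist _ (profile_ge0 (uU n) y)) _.
  exact: leeD2l.
have inv_small (e : R) : (0 < e)%R ->
    \forall m \near \oo, (m.+1%:R^-1)%:E <= e%:E.
  move=> e0; apply: filterS (near_infty_natSinv_lt (PosNum e0)) => m.
  by rewrite lee_fin => /ltW.
have [x [gx dx xE]] := diagonal_sequence uU.
have dx_near n j : \forall m \near \oo,
    d (u n j) (x m) <= g m (u n j) + (m.+1%:R^-1)%:E.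
  exists (maxn n j) => // m /=; rewrite geq_max => /andP[nm jm]; exact: dx.
(* With [n] fixed and [m] large, [d (x n) (x m) <= g m (x n) + e/4 <= g n (x n) + e/4 + e/4 <=
   3e/4]. *)
have x_adm : forwards_admissible d x.
  apply/forwards_admissibleP => e e0.
  have e4 : (0 < e / 4)%R by rewrite divr_gt0.
  apply: filterS2 (inv_small _ e4) (g_adm _ e4) => n n_inv gn.
  have [j xnE] := xE n.
  apply: filterS3 (dx_near n j) (inv_small _ e4) gn => m; rewrite -xnE.
  move=> dxm m_inv gnm; apply: (le_lt_trans dxm).
  apply: (@le_lt_trans _ _ ((e / 4)%:E + (e / 4)%:E + (e / 4)%:E)).
    by rewrite leeD// (le_trans (gnm _))// leeD2r// (le_trans (gx n)).
  by rewrite -!EFinD lte_fin; lra.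
have [h xh] := exists_represents x_adm.
exists (exist _ h (ex_intro _ x xh) : completion); split=> [|[k [v vk]] Uk].
  apply/cvg0_leP => [n|e e0]; first exact: profile_dist_ge0.
  have e2 : (0 < e / 2)%R by rewrite divr_gt0.
  apply: filterS (g_adm _ e2) => n gn.
  apply: profile_dist_le; first by rewrite lee_fin ltW.
  (* It suffices to bound [h] along [u n]: there [d (u n j) (x m) <= g m (u n j) + e/2 <= g n (u n
     j) + e] for large [m], and [g n (u n j)] tends to 0 in [j]. *)
  apply: (profile_le_add (b := fun j => g n (u n j) + e%:E) (uU n)).
  - by rewrite lee_fin ltW.
  - exact: profile_triangle xh.
  - apply: nearW => j; apply: (cvge_to_le (xh.2 _)).
    apply: filterS3 (dx_near n j) (inv_small _ e2) gn => m dxm m_inv gnm.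
    have -> : e%:E = (e / 2)%:E + (e / 2)%:E by rewrite -EFinD -splitr.
    by rewrite addeA; exact: le_trans dxm (leeD (gnm _) m_inv).
  - suff : g n (u n j) + e%:E @[j --> \oo] --> 0 + e%:E by rewrite add0e.
    apply: ge0_cvgeD => //.
    + by rewrite lee_fin ltW.
    + exact: profile_cvg0 (uU n).
    + exact: cvg_cst.
(* For closestness, [k (x m)] is at most [g m (x m)] plus the distance from [U m] to [k]. Both tend
   to 0, whereas [k (x m)] tends to the distance from [h] to [k]. *)
have gx0 : g m (x m) @[m --> \oo] --> 0.
  apply/cvg0_leP => [m|e e0]; first exact: profile_ge0 (uU m) _.
  by apply: filterS (inv_small e e0) => m; exact: le_trans (gx m).
have bound := ge0_cvgeD (lexx 0) (lexx 0) gx0 Uk.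
apply/eqP; rewrite eq_le profile_dist_ge0 andbT -[leRHS]adde0.
apply: (lee_cvg_to (cvg_profile_dist xh vk) bound); apply: nearW => m.
exact: le_add_profile_dist (profile_ge0 (uU m) _).
Qed.

End Profiles.

(** * Sequences in the image of an embedding, and existence of the completion *)

Lemma isometric_admissible (R : realType) (X Y : Type) (d : X -> X -> \bar R)
    (dY : Y -> Y -> \bar R) (f : X -> Y) (u : nat -> X) :
  isometric_embedding d dY f ->
  forwards_admissible dY (f \o u) <-> forwards_admissible d u.
Proof.
by move=> f_iso; split=> /forwards_admissibleP u_adm;
  apply/forwards_admissibleP => e e0; apply: filterS (u_adm e e0) => m;
  apply: filterS => k; rewrite /= f_iso.
Qed.

Lemma range_sequence (X Y : Type) (f : X -> Y) (a : nat -> Y) :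
  (forall m, range f (a m)) -> exists u : nat -> X, a = f \o u.
Proof.
move=> a_range; have /choice[u uP] : forall m, exists x, f x = a m.
  by move=> m; have [x _ <-] := a_range m; exists x.
by exists u; apply/funext => m /=; rewrite uP.
Qed.

Lemma forwards_completion_exists (R : realType) (X : Type)
    (d : X -> X -> \bar R) (d_metric : asymmetric_metric d) :
  forwards_completion d (@completion_dist R X d) (completion_embed d_metric).
Proof.
have iota_iso := completion_embed_isometric d_metric.
have hat_metric := completion_dist_metric d_metric.
split=> //; first exact: completion_forwards_complete.
- move=> a b _ _ /range_sequence[u ->] /range_sequence[v ->].
  move=> /(isometric_admissible _ iota_iso) u_adm.
  move=> /(isometric_admissible _ iota_iso) v_adm ua vb.
  have [g ug] := exists_represents d_metric u_adm.
  have [h vh] := exists_represents d_metric v_adm.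
  pose G : completion d := exist _ g (ex_intro _ u ug).
  pose H : completion d := exist _ h (ex_intro _ v vh).
  have uG := @represents_is_CFL _ _ _ d_metric u G ug.
  have vH := @represents_is_CFL _ _ _ d_metric v H vh.
  (* The given limits must be the profiles of [u] and [v], so the inner limits are the values
     [h (u m)]. *)
  rewrite (is_CFL_unique hat_metric ua uG) (is_CFL_unique hat_metric vb vH).
  exists (h \o u) => [m|]; last exact: (cvg_profile_dist d_metric ug vh).
  by under eq_fun do rewrite /= iota_iso; exact: vh.2.
- move=> G; have [u uG] := svalP G.
  exists (completion_embed d_metric \o u); split.
  + by move=> m; exists (u m).
  + by apply/(isometric_admissible _ iota_iso); exact: uG.1.
  + exact: represents_is_CFL.
Qed.

(** * Uniqueness of the completion *)

Section Uniqueness.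
Variables (R : realType) (X : Type) (d : X -> X -> \bar R).
Hypothesis d_metric : asymmetric_metric d.

(** The graph of the isometry to be built. Its symmetry in the two completions supplies the
    inverse. *)
Definition same_limit (X1 X2 : Type) (d1 : X1 -> X1 -> \bar R)
    (d2 : X2 -> X2 -> \bar R) (iota1 : X -> X1) (iota2 : X -> X2)
    (a1 : X1) (a2 : X2) : Prop :=
  exists u, [/\ forwards_admissible d u, is_CFL d1 (iota1 \o u) a1 &
                is_CFL d2 (iota2 \o u) a2].

(** The left side involves [d] alone, so distances do not depend on the completion. *)
Lemma completion_dist_limit (Y : Type) (dY : Y -> Y -> \bar R) (iota : X -> Y)
    (u v : nat -> X) (a b : Y) :
  forwards_completion d dY iota ->
  forwards_admissible d u -> forwards_admissible d v ->
  is_CFL dY (iota \o u) a -> is_CFL dY (iota \o v) b ->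
  limn (fun m => limn (fun k => d (u m) (v k))) = dY a b.
Proof.
move=> [_ _ iota_iso semi _] u_adm v_adm ua vb.
have [|||| l lE lab] := semi a b (iota \o u) (iota \o v) _ _ _ _ ua vb.
- by move=> m; exists (u m).
- by move=> m; exists (v m).
- exact/(isometric_admissible _ iota_iso).
- exact/(isometric_admissible _ iota_iso).
apply: cvg_lim => //; rewrite [X in X @ _ --> _](_ : _ = l)//.
apply/funext => m; apply: cvg_lim => //.
by have := lE m; under eq_fun do rewrite /= iota_iso.
Qed.

Variables (X1 : Type) (d1 : X1 -> X1 -> \bar R) (iota1 : X -> X1).
Variables (X2 : Type) (d2 : X2 -> X2 -> \bar R) (iota2 : X -> X2).
Hypotheses (C1 : forwards_completion d d1 iota1)
           (C2 : forwards_completion d d2 iota2).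

Lemma same_limit_isometric (a1 b1 : X1) (a2 b2 : X2) :
  same_limit d1 d2 iota1 iota2 a1 a2 -> same_limit d1 d2 iota1 iota2 b1 b2 ->
  d2 a2 b2 = d1 a1 b1.
Proof.
move=> [u [u_adm ua1 ua2]] [v [v_adm vb1 vb2]].
rewrite -(completion_dist_limit C1 u_adm v_adm ua1 vb1).
by rewrite -(completion_dist_limit C2 u_adm v_adm ua2 vb2).
Qed.

(** Density of the first completion provides the sequence, completeness of the second its limit. *)
Lemma same_limit_total (a1 : X1) :
  exists a2, same_limit d1 d2 iota1 iota2 a1 a2.
Proof.
case: C1 C2 => [_ _ iso1 _ dense1] [_ complete2 iso2 _ _].
have [_ [/range_sequence[u ->]]] := dense1 a1.
move=> /(isometric_admissible _ iso1) u_adm ua1.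
have /complete2[a2 ua2] : forwards_admissible d2 (iota2 \o u).
  exact/(isometric_admissible _ iso2).
by exists a2, u.
Qed.

Lemma same_limit_cst (x : X) : same_limit d1 d2 iota1 iota2 (iota1 x) (iota2 x).
Proof.
exists (fun=> x); split; first exact: admissible_cst.
- exact: is_CFL_cst (completion_metric C1) _.
- exact: is_CFL_cst (completion_metric C2) _.
Qed.

(** Two partners of [a1] are at distance [d1 a1 a1 = 0] in both directions. *)
Lemma same_limit_functional (a1 : X1) (a2 b2 : X2) :
  same_limit d1 d2 iota1 iota2 a1 a2 -> same_limit d1 d2 iota1 iota2 a1 b2 ->
  a2 = b2.
Proof.
move=> aa ab; apply: (asym_sep (completion_metric C2)).
  by rewrite (same_limit_isometric aa ab) (asym_refl (completion_metric C1)).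
by rewrite (same_limit_isometric ab aa) (asym_refl (completion_metric C1)).
Qed.

End Uniqueness.

Lemma same_limit_sym (R : realType) (X X1 X2 : Type) (d : X -> X -> \bar R)
    (d1 : X1 -> X1 -> \bar R) (d2 : X2 -> X2 -> \bar R)
    (iota1 : X -> X1) (iota2 : X -> X2) (a1 : X1) (a2 : X2) :
  same_limit d d1 d2 iota1 iota2 a1 a2 -> same_limit d d2 d1 iota2 iota1 a2 a1.
Proof. by move=> [u [? ? ?]]; exists u. Qed.

Lemma forwards_completion_unique (R : realType) (X : Type)
    (d : X -> X -> \bar R) (d_metric : asymmetric_metric d)
    (X1 : Type) (d1 : X1 -> X1 -> \bar R) (iota1 : X -> X1)
    (X2 : Type) (d2 : X2 -> X2 -> \bar R) (iota2 : X -> X2) :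
  forwards_completion d d1 iota1 -> forwards_completion d d2 iota2 ->
  exists phi : X1 -> X2,
    asym_isometry d1 d2 phi /\ forall x : X, phi (iota1 x) = iota2 x.
Proof.
move=> C1 C2.
have /choice[phi phiP] := same_limit_total C1 C2.
have /choice[psi psiP] := same_limit_total C2 C1.
exists phi; split; [split|].
- by move=> a b; exact: same_limit_isometric C1 C2 _ _ _ _ (phiP a) (phiP b).
- exists psi => [a1|a2].
    exact: same_limit_functional C2 C1 _ _ _ (psiP _) (same_limit_sym (phiP a1)).
  exact: same_limit_functional C1 C2 _ _ _ (phiP _) (same_limit_sym (psiP a2)).
(* The constant sequence at [x] relates [iota1 x] to [iota2 x]. *)
- move=> x; apply: (same_limit_functional C1 C2 (phiP _)).
  exact: same_limit_cst.
Qed.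

Theorem theorem1 (R : realType) (X : Type) (d : X -> X -> \bar R)
    (d_metric : asymmetric_metric d)
    (d_continuous : forwards_continuous d)
    (d_star : CFL_are_CBL d) :
  (exists (Xhat : Type) (dhat : Xhat -> Xhat -> \bar R) (iota : X -> Xhat),
     forwards_completion d dhat iota) /\
  (forall (X1 : Type) (d1 : X1 -> X1 -> \bar R) (iota1 : X -> X1)
          (X2 : Type) (d2 : X2 -> X2 -> \bar R) (iota2 : X -> X2),
     forwards_completion d d1 iota1 ->
     forwards_completion d d2 iota2 ->
     exists phi : X1 -> X2,
       asym_isometry d1 d2 phi /\ forall x : X, phi (iota1 x) = iota2 x).
Proof.
split.
  exists (completion d), (@completion_dist R X d), (completion_embed d_metric).
  exact: forwards_completion_exists.
by move=> X1 d1 iota1 X2 d2 iota2; exact: forwards_completion_unique.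
Qed.
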